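(* Let $\mathbf{A}$ be a Grothendieck category with a metric $d$, and let $1\le p\le\infty$. Then $W_p(d)$ is a metric on $\mathbf{A}_\ell$.
   Context: A metric on a category (or on a class of objects in it) is a function $d$ assigning to each pair of objects a value in $[0,\infty]$ such that $d(M,M)=0$, $d(M,N)=d(N,M)$, $d(M,Q)\le d(M,N)+d(N,Q)$, and $d(M,N)=0$ whenever $M\cong N$ (nonisomorphic objects may have distance $0$). $\mathbf{A}_\ell$ is the full subcategory of $\mathbf{A}$ whose objects are those isomorphic to a direct sum (with arbitrary index set) of objects with a local endomorphism ring. For a family $x=\{x_a\}_{a\in A}$ in $[0,\infty]$, $\|x\|_p=(\sum_a x_a^p)^{1/p}\in[0,\infty]$ for $p<\infty$ and $\|x\|_\infty=\sup_a x_a$. For $M,N\in\mathbf{A}_\ell$, $W_p(d)(M,N)=\inf\|\{d(M_a,N_a)\}_{a\in A}\|_p$, where the infimum is over all isomorphisms $M\cong\bigoplus_{a\in A}M_a$ and $N\cong\bigoplus_{a\in A}N_a$ (common index set $A$) in which each $M_a$ and each $N_a$ is either $0$ or has a local endomorphism ring. *)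

(* Defs.v *)
From HB Require Import structures.
From mathcomp Require Import all_boot all_order all_algebra.
From mathcomp Require Import all_classical all_reals all_analysis.

Set Implicit Arguments.
Unset Strict Implicit.
Unset Printing Implicit Defensive.

Import Order.TTheory GRing.Theory Num.Theory.

Local Open Scope classical_set_scope.
Local Open Scope ring_scope.

(* Size convention: hom-sets are (carriers of) zmodTypes and all index sets are
   choiceTypes, which makes both small; the type of objects is in an
   independent, possibly larger, universe. Being a choiceType is no restriction
   on an index set, since every type is one under the axioms of boolp. *)

Record preadditive := Preadditive {
  obj :> Type;
  hom : obj -> obj -> zmodType;
  idhom : forall X, hom X X;
  compm : forall X Y Z, hom Y Z -> hom X Y -> hom X Z;
  compmA : forall X Y Z W (h : hom Z W) (g : hom Y Z) (f : hom X Y),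
    compm h (compm g f) = compm (compm h g) f;
  comp1m : forall X Y (f : hom X Y), compm (idhom Y) f = f;
  compm1 : forall X Y (f : hom X Y), compm f (idhom X) = f;
  compmDl : forall X Y Z (g1 g2 : hom Y Z) (f : hom X Y),
    compm (g1 + g2) f = compm g1 f + compm g2 f;
  compmDr : forall X Y Z (g : hom Y Z) (f1 f2 : hom X Y),
    compm g (f1 + f2) = compm g f1 + compm g f2
}.
Arguments hom {p} _ _.
Arguments idhom {p} _.
Arguments compm {p X Y Z} _ _.

Local Notation "g \c f" := (compm g f) (at level 40, left associativity).

Section Preadditive.
Variable C : preadditive.
Implicit Types X Y Z K Q G : C.

Definition isomorphic X Y :=
  exists (f : hom X Y) (g : hom Y X), g \c f = idhom X /\ f \c g = idhom Y.

Definition is_mono X Y (f : hom X Y) :=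
  forall Z (g h : hom Z X), f \c g = f \c h -> g = h.

Definition is_epi X Y (f : hom X Y) :=
  forall Z (g h : hom Y Z), g \c f = h \c f -> g = h.

Definition is_kernel X Y K (f : hom X Y) (k : hom K X) :=
  f \c k = 0 /\
  forall Z (g : hom Z X), f \c g = 0 -> exists! u : hom Z K, k \c u = g.

Definition is_cokernel X Y Q (f : hom X Y) (q : hom Y Q) :=
  q \c f = 0 /\
  forall Z (g : hom Y Z), g \c f = 0 -> exists! u : hom Q Z, u \c q = g.

Definition is_zero X :=
  (forall Y (f : hom X Y), f = 0) /\ (forall Y (f : hom Y X), f = 0).

Definition is_biproduct X Y S
    (i1 : hom X S) (i2 : hom Y S) (p1 : hom S X) (p2 : hom S Y) :=
  [/\ p1 \c i1 = idhom X, p2 \c i2 = idhom Y, p2 \c i1 = 0, p1 \c i2 = 0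
    & i1 \c p1 + i2 \c p2 = idhom S].

Record is_abelian : Prop := IsAbelian {
  ab_zero : exists X : C, is_zero X;
  ab_biproduct : forall X Y, exists S (i1 : hom X S) (i2 : hom Y S)
    (p1 : hom S X) (p2 : hom S Y), is_biproduct i1 i2 p1 p2;
  ab_kernel : forall X Y (f : hom X Y), exists K (k : hom K X), is_kernel f k;
  ab_cokernel : forall X Y (f : hom X Y),
    exists Q (q : hom Y Q), is_cokernel f q;
  ab_mono : forall X Y (f : hom X Y), is_mono f ->
    exists Z (g : hom Y Z), is_kernel g f;
  ab_epi : forall X Y (f : hom X Y), is_epi f ->
    exists Z (g : hom Z X), is_cokernel g f
}.

Definition is_coproduct (A : choiceType) (F : A -> C) (S : C)
    (inj : forall a, hom (F a) S) :=
  forall X (g : forall a, hom (F a) X),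
    exists! u : hom S X, forall a, u \c inj a = g a.

(* 0 -> X -> Y -> Z -> 0 is exact *)
Definition short_exact X Y Z (f : hom X Y) (g : hom Y Z) :=
  is_kernel g f /\ is_cokernel f g.

Definition directed (I : choiceType) (le : rel I) :=
  [/\ exists i : I, True, reflexive le, transitive le
    & forall i j, exists k, le i k && le j k].

Record direct_system (I : choiceType) (le : rel I) := DirectSystem {
  ds_obj :> I -> C;
  ds_map : forall i j, le i j -> hom (ds_obj i) (ds_obj j);
  ds_id : forall i (h : le i i), ds_map h = idhom (ds_obj i);
  ds_comp : forall i j k (hij : le i j) (hjk : le j k) (hik : le i k),
    ds_map hjk \c ds_map hij = ds_map hik
}.

Definition is_cocone (I : choiceType) (le : rel I) (D : direct_system le)
    (L : C) (c : forall i, hom (D i) L) :=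
  forall i j (h : le i j), c j \c ds_map D h = c i.

Definition is_direct_limit (I : choiceType) (le : rel I)
    (D : direct_system le) (L : C) (c : forall i, hom (D i) L) :=
  is_cocone c /\
  forall X (g : forall i, hom (D i) X), is_cocone g ->
    exists! u : hom L X, forall i, u \c c i = g i.

Definition is_natural (I : choiceType) (le : rel I) (D E : direct_system le)
    (f : forall i, hom (D i) (E i)) :=
  forall i j (h : le i j), f j \c ds_map D h = ds_map E h \c f i.

Definition exact_direct_limits :=
  forall (I : choiceType) (le : rel I), directed le ->
  forall (D1 D2 D3 : direct_system le)
    (f : forall i, hom (D1 i) (D2 i)) (g : forall i, hom (D2 i) (D3 i)),
  is_natural f -> is_natural g -> (forall i, short_exact (f i) (g i)) ->
  forall (L1 L2 L3 : C) (c1 : forall i, hom (D1 i) L1)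
    (c2 : forall i, hom (D2 i) L2) (c3 : forall i, hom (D3 i) L3),
  is_direct_limit c1 -> is_direct_limit c2 -> is_direct_limit c3 ->
  forall (lf : hom L1 L2) (lg : hom L2 L3),
  (forall i, lf \c c1 i = c2 i \c f i) ->
  (forall i, lg \c c2 i = c3 i \c g i) ->
  short_exact lf lg.

Definition is_generator G :=
  forall X Y (f g : hom X Y), f <> g -> exists h : hom G X, f \c h <> g \c h.

Record is_grothendieck : Prop := IsGrothendieck {
  gr_abelian : is_abelian;
  gr_coproduct : forall (A : choiceType) (F : A -> C),
    exists S (inj : forall a, hom (F a) S), is_coproduct inj;
  gr_exact : exact_direct_limits;
  gr_generator : exists G : C, is_generator G
}.

(* M is isomorphic to the direct sum of the family F *)
Definition is_direct_sum (M : C) (A : choiceType) (F : A -> C) :=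
  exists (S : C) (inj : forall a, hom (F a) S),
    is_coproduct inj /\ isomorphic M S.

End Preadditive.

Definition endo (C : preadditive) (X : C) : Type := hom X X.

Section EndomorphismRing.
Variables (C : preadditive) (X : C).

HB.instance Definition _ := GRing.Zmodule.on (endo X).
HB.instance Definition _ := GRing.Zmodule_isPzRing.Build (endo X)
  (@compmA C X X X X) (@comp1m C X X) (@compm1 C X X)
  (@compmDl C X X X) (@compmDr C X X X).

End EndomorphismRing.

(* Two-sided inverses, and the zero ring is allowed: neither is available for
   GRing.unit, which needs a chosen inverse function on a nonzero ring. *)
Definition invertible (R : pzRingType) (x : R) :=
  exists y : R, y * x = 1 /\ x * y = 1.

Definition local_ring (R : pzRingType) :=
  (1 : R) <> 0 /\
  forall x y : R, ~ invertible x -> ~ invertible y -> ~ invertible (x + y).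

Definition has_local_endo (C : preadditive) (X : C) :=
  local_ring (endo X : pzRingType).

Record full_obj (C : preadditive) (P : C -> Prop) := FullObj {
  full_val :> C;
  full_prop : P full_val
}.

Definition full_subcategory (C : preadditive) (P : C -> Prop) : preadditive :=
  {| obj := full_obj P;
     hom := fun X Y => hom (full_val X) (full_val Y);
     idhom := fun X => idhom (full_val X);
     compm := fun X Y Z g f => compm g f;
     compmA := fun X Y Z W h g f => compmA h g f;
     comp1m := fun X Y f => comp1m f;
     compm1 := fun X Y f => compm1 f;
     compmDl := fun X Y Z g1 g2 f => compmDl g1 g2 f;
     compmDr := fun X Y Z g f1 f2 => compmDr g f1 f2 |}.

(* The category A_l *)
Definition locally_decomposable (C : preadditive) : preadditive :=
  full_subcategory (fun M : C => exists (A : choiceType) (F : A -> C),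
    (forall a, has_local_endo (F a)) /\ is_direct_sum M F).

Local Open Scope ereal_scope.

Record is_metric (R : realType) (C : preadditive) (d : C -> C -> \bar R)
  : Prop := IsMetric {
  metric_ge0 : forall M N, 0 <= d M N;
  metric_refl : forall M, d M M = 0;
  metric_sym : forall M N, d M N = d N M;
  metric_triangle : forall M N Q, d M Q <= d M N + d N Q;
  metric_iso : forall M N, isomorphic M N -> d M N = 0
}.

(* For p = +oo, the supremum is taken in [0, +oo], so it is 0 on the empty
   family (ereal_sup set0 is -oo); the value at p = -oo is irrelevant. *)
Definition lp_norm (R : realType) (p : \bar R) (A : choiceType)
    (x : A -> \bar R) : \bar R :=
  match p with
  | r%:E => (\esum_(a in [set: A]) x a `^ r) `^ r^-1
  | +oo => ereal_sup (0 |` range x)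
  | -oo => 0
  end.

Definition zero_or_local (C : preadditive) (X : C) :=
  is_zero X \/ has_local_endo X.

Definition wasserstein (R : realType) (C : preadditive) (p : \bar R)
    (d : C -> C -> \bar R) (M N : locally_decomposable C) : \bar R :=
  ereal_inf [set w | exists (A : choiceType) (F G : A -> C),
    [/\ is_direct_sum (full_val M) F, is_direct_sum (full_val N) G,
        forall a, zero_or_local (F a), forall a, zero_or_local (G a)
      & w = lp_norm p (fun a => d (F a) (G a))]].

(* Main.v *)
(** By the Krull-Remak-Schmidt-Azumaya theorem, two decompositions of an object
    into objects with local endomorphism rings agree up to isomorphism and a
    bijection of the index sets; the triangle inequality then follows, after
    padding with zeros, from the one for [d] and Minkowski's inequality.

    For Azumaya's theorem, let [N] be the coproduct of the [G a] and of the
    [H b]. Exactness of direct limits shows that a nonzero subobject of [N]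
    meets a finite partial sum nontrivially. Hence every [G a] is isomorphic to
    some [H b] through the coprojections and projections of [N], and a given
    [H b] arises in this way from finitely many [a] only. Fix an isomorphism
    class, and let [I] and [J] be the sets of those [a] and [b] in it. If [J] is
    infinite, there is a map from [I] to [J] with finite fibres, so [I] embeds
    in [J]. If [J] is finite and [I] had more elements than [J], some nonzero
    combination of the coprojections of the [G a] would have noninvertible
    components on all [H b], which is impossible. By symmetry and
    Cantor-Bernstein, [I] and [J] have the same cardinality. *)

From mathcomp Require Import all_boot all_order all_algebra.
From mathcomp Require Import finmap ring.
From mathcomp Require Import all_classical all_reals all_analysis.
Require Import Defs.

Set Implicit Arguments.
Unset Strict Implicit.
Unset Printing Implicit Defensive.

Import Order.TTheory GRing.Theory Num.Theory.

Local Open Scope classical_set_scope.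
Local Open Scope ring_scope.

Local Notation "g \c f" := (compm g f) (at level 40, left associativity).

(** * Local endomorphism rings *)

Section Morphisms.
Variable C : preadditive.
Implicit Types X Y Z W : C.

Lemma comp0m X Y Z (f : hom X Y) : (0 : hom Y Z) \c f = 0.
Proof. by apply: (addIr ((0 : hom Y Z) \c f)); rewrite -compmDl !add0r. Qed.

Lemma compm0 X Y Z (g : hom Y Z) : g \c (0 : hom X Y) = 0.
Proof. by apply: (addIr (g \c (0 : hom X Y))); rewrite -compmDr !add0r. Qed.

Lemma compmN X Y Z (g : hom Y Z) (f : hom X Y) : g \c (- f) = - (g \c f).
Proof. by apply/eqP; rewrite -addr_eq0 -compmDr addNr compm0. Qed.

Lemma compNm X Y Z (g : hom Y Z) (f : hom X Y) : (- g) \c f = - (g \c f).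
Proof. by apply/eqP; rewrite -addr_eq0 -compmDl addNr comp0m. Qed.

Lemma compm_sumr X Y Z (I : Type) (r : seq I) (g : hom Y Z) (f : I -> hom X Y) :
  g \c (\sum_(i <- r) f i) = \sum_(i <- r) (g \c f i).
Proof. by elim/big_rec2: _ => [|i u v _ <-]; rewrite ?compm0 ?compmDr. Qed.

Definition is_iso X Y (f : hom X Y) :=
  exists g : hom Y X, g \c f = idhom X /\ f \c g = idhom Y.

Lemma is_iso_comp X Y Z (g : hom Y Z) (f : hom X Y) :
  is_iso g -> is_iso f -> is_iso (g \c f).
Proof.
move=> [g' [g'g gg']] [f' [f'f ff']]; exists (f' \c g'); split.
  by rewrite compmA -(compmA f') g'g compm1.
by rewrite compmA -(compmA g) ff' compm1.
Qed.

Lemma is_iso_mono X Y (f : hom X Y) : is_iso f -> is_mono f.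
Proof.
by move=> [g [gf _]] Z u v /(congr1 (compm g)); rewrite !compmA gf !comp1m.
Qed.

Lemma is_mono_compr X Y Z (g : hom Y Z) (f : hom X Y) :
  is_mono (g \c f) -> is_mono f.
Proof. by move=> m W u v uv; apply: m; rewrite -!compmA uv. Qed.

Lemma isomorphic_refl X : isomorphic X X.
Proof. by exists (idhom X), (idhom X); rewrite !comp1m. Qed.

Lemma isomorphic_sym X Y : isomorphic X Y -> isomorphic Y X.
Proof. by move=> [f [g [gf fg]]]; exists g, f. Qed.

Lemma isomorphic_trans X Y Z :
  isomorphic X Y -> isomorphic Y Z -> isomorphic X Z.
Proof.
move=> [f fi] [g gi]; have [h ?] := is_iso_comp gi fi.
by exists (g \c f), h.
Qed.

Lemma is_zero_isomorphic X Y : is_zero X -> is_zero Y -> isomorphic X Y.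
Proof.
by move=> [X1 X2] [Y1 Y2]; exists 0, 0; split;
  [rewrite (X1 _ (idhom X)) (X1 _ (_ \c _))
  |rewrite (Y1 _ (idhom Y)) (Y1 _ (_ \c _))].
Qed.

Lemma local_endo_id X : has_local_endo X -> idhom X <> 0.
Proof. by case. Qed.

Lemma local_endo_add X (f g : hom X X) : has_local_endo X ->
  is_iso (f + g) -> is_iso f \/ is_iso g.
Proof.
move=> [_ lX] fg; have [?|nf] := pselect (is_iso f); first by left.
by right; apply: contrapT => ng; apply: (lX f g nf ng).
Qed.

(* With [h] the inverse of [g \c f], the endomorphism [f \c h \c g] of [Y] is
   idempotent, so it is [0] or the identity because [Y] is local. *)
Lemma local_endo_comp X Y Z (g : hom Y Z) (f : hom X Y) :
  has_local_endo Y -> idhom X <> 0 -> is_iso (g \c f) -> is_iso f /\ is_iso g.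
Proof.
move=> lY X0 [h [hgf gfh]].
have hgf' : h \c g \c f = idhom X by rewrite -compmA.
have gfh' : g \c (f \c h) = idhom Z by rewrite compmA.
pose t := f \c h \c g.
have tf : t \c f = f by rewrite /t -compmA -compmA hgf compm1.
have tt : t \c t = t by rewrite {2}/t !compmA tf.
have : is_iso (t + (idhom Y - t)).
  by rewrite addrC subrK; exists (idhom Y); rewrite !comp1m.
case/(local_endo_add lY) => [[u [ut tu]]|[u [ut _]]]; last first.
  case: X0; rewrite -hgf' -tf -(comp1m t) -ut -(compmA u) compmDl compNm tt.
  by rewrite comp1m subrr compm0 comp0m compm0.
have t1 : t = idhom Y by rewrite -ut -{2}tt compmA ut comp1m.
split; first by exists (h \c g); split; rewrite // compmA.
by exists (f \c h).
Qed.

(** Composing with the inverse [h] of [f + g] gives endomorphisms of [X]; if [h \c f] is invertible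
    then so is [f], because [Y] is local. *)
Lemma local_endo_hom_add X Y (f g : hom X Y) : has_local_endo X ->
  has_local_endo Y -> is_iso (f + g) -> is_iso f \/ is_iso g.
Proof.
move=> lX lY [h [hfg _]]; have X0 := local_endo_id lX.
have : is_iso (h \c f + h \c g).
  by rewrite -compmDr hfg; exists (idhom X); rewrite !comp1m.
by case/(local_endo_add lX) => /(local_endo_comp lY X0)[]; [left|right].
Qed.

Lemma local_endo_hom_sum X Y (I : eqType) (r : seq I) (f : I -> hom X Y) :
  has_local_endo X -> has_local_endo Y -> is_iso (\sum_(i <- r) f i) ->
  exists2 i, i \in r & is_iso (f i).
Proof.
move=> lX lY; elim: r => [|i r IHr].
  rewrite big_nil => -[g [g0 _]]; case: (local_endo_id lX).
  by rewrite -g0 compm0.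
rewrite big_cons => /(local_endo_hom_add lX lY)[fi|/IHr[j jr fj]].
  by exists i; rewrite ?mem_head.
by exists j; rewrite ?in_cons ?jr ?orbT.
Qed.

(* Gaussian elimination modulo the radical: a homogeneous system with more
   unknowns than equations has a solution that does not vanish there. *)
Lemma local_linear_system (I J : eqType) (G : I -> C) (H : J -> C) (X : C)
    (s : seq J) (t : seq I) (x : forall j i, hom (G i) (H j)) :
  has_local_endo X ->
  (forall i, i \in t -> has_local_endo (G i)) ->
  (forall j, j \in s -> has_local_endo (H j)) ->
  (forall i, i \in t -> isomorphic X (G i)) ->
  uniq t -> (size s < size t)%N ->
  exists c : forall i, hom X (G i),
    (exists2 i, i \in t & is_iso (c i)) /\
    (forall j, j \in s -> ~ is_iso (\sum_(i <- t) (x j i \c c i))).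
Proof.
move=> lX; elim: s t x => [|j s IHs] t x lG lH XG ut st.
  case: t lG XG ut st => // i t lG XG ut _.
  have [f fi] := XG i (mem_head _ _).
  exists (eqtype.dfwith (fun k => 0 : hom X (G k)) f); split=> //.
  by exists i; rewrite ?mem_head// dfwith_in.
have lHs k : k \in s -> has_local_endo (H k).
  by move=> ks; apply: lH; rewrite in_cons ks orbT.
have lHj := lH j (mem_head _ _).
have [[l lt [g [gx xg]]]|nj] :=
    pselect (exists2 l, l \in t & is_iso (x j l)); last first.
  (* Without a pivot in equation [j], a solution of the other equations will do: an invertible sum
     has an invertible term, which would make some [x j i] invertible. *)
  have [|c [ci cs]] := IHs t x lG lHs XG ut; first exact: ltn_trans st.
  exists c; split => // k; rewrite in_cons => /predU1P[->|/cs//].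
  move=> /(local_endo_hom_sum lX lHj)[i it].
  move=> /(local_endo_comp (lG i it) (local_endo_id lX))[_ xi].
  by apply: nj; exists i.
pose t' := rem l t.
have tt' i : i \in t' -> i \in t by exact: mem_rem.
have lt' i : i \in t' -> l != i.
  by move=> it'; apply: contraTneq it' => <-; rewrite mem_rem_uniq// inE eqxx.
(* The pivot [x j l] eliminates the unknown [l], whose value [- (g \c d)] below solves equation [j]
   exactly. *)
have [|||||c [[i it' ci] cs]] :=
    IHs t' (fun k i => x k i - x k l \c (g \c x j i)).
- by move=> i /tt'/lG.
- by [].
- by move=> i /tt'/XG.
- exact: rem_uniq.
- by rewrite /t' size_rem// -ltnS prednK //; case: (t) lt.
pose d := \sum_(i <- t') (x j i \c c i).
have sumE k : \sum_(i <- t) (x k i \c eqtype.dfwith c (- (g \c d)) i) =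
    \sum_(i <- t') (x k i \c c i) - x k l \c (g \c d).
  rewrite (perm_big _ (perm_to_rem lt)) big_cons dfwith_in compmN [RHS]addrC.
  congr (_ + _); apply: eq_big_seq => i' i't'.
  by rewrite dfwith_out// lt'.
exists (eqtype.dfwith c (- (g \c d))); split.
  by exists i; [exact: tt'|rewrite dfwith_out// lt'].
move=> k; rewrite sumE in_cons => /predU1P[->|ks].
  rewrite compmA xg comp1m subrr => -[h [h0 _]]; case: (local_endo_id lX).
  by rewrite -h0 compm0.
suff -> : \sum_(i0 <- t') x k i0 \c c i0 - x k l \c (g \c d) =
   \sum_(i <- t') (x k i - x k l \c (g \c x j i)) \c c i by exact: cs.
rewrite /d !compm_sumr -sumrN -big_split/=; apply: eq_bigr => i' _.
by rewrite compmDl compNm !compmA.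
Qed.

End Morphisms.

(** * Coproducts and exact direct limits *)

Section Coproduct.
Variables (C : preadditive) (A : choiceType) (F : A -> C) (S : C).
Variables (inj : forall a, hom (F a) S) (cS : is_coproduct inj).
Implicit Types (X : C) (P Q : pred A).

Lemma coproduct_ext X (u v : hom S X) :
  (forall a, u \c inj a = v \c inj a) -> u = v.
Proof.
move=> uv; have [w [_ wu]] := cS (fun a => v \c inj a).
by rewrite -(wu u uv) -(wu v).
Qed.

Definition copair X (g : forall a, hom (F a) X) : hom S X := sval (cid (cS g)).

Lemma copairE X (g : forall a, hom (F a) X) a : copair g \c inj a = g a.
Proof. by rewrite /copair; case: cid => u [/= ->]. Qed.

Definition coproj b : hom S (F b) :=
  copair (eqtype.dfwith (fun a => 0 : hom (F a) (F b)) (idhom (F b))).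

Lemma coproj_id a : coproj a \c inj a = idhom (F a).
Proof. by rewrite copairE dfwith_in. Qed.

Lemma coproj_neq a b : b != a -> coproj b \c inj a = 0.
Proof. by move=> ba; rewrite copairE dfwith_out. Qed.

(** The idempotent of [S] that keeps the summands in [P] and kills the others; it stands in for the
    partial sum over [P]. *)
Definition cut P : hom S S := copair (fun a => if P a then inj a else 0).

Lemma cut_inj P a : cut P \c inj a = if P a then inj a else 0.
Proof. exact: copairE. Qed.

Lemma eq_cut P Q : P =1 Q -> cut P = cut Q.
Proof. by move=> PQ; apply: coproduct_ext => a; rewrite !cut_inj PQ. Qed.

Lemma cut_id P : (forall a, P a) -> cut P = idhom S.
Proof. by move=> PT; apply: coproduct_ext => a; rewrite cut_inj PT comp1m. Qed.

Lemma cut_comp P Q : cut P \c cut Q = cut (predI P Q).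
Proof.
apply: coproduct_ext => a; rewrite -compmA !cut_inj /=.
by case: (Q a); rewrite ?compm0 ?andbF ?cut_inj ?andbT.
Qed.

Lemma cut_compl P : cut P + cut (predC P) = idhom S.
Proof.
apply: coproduct_ext => a; rewrite compmDl !cut_inj comp1m/=.
by case: (P a); rewrite ?addr0 ?add0r.
Qed.

Lemma cut0 P : (forall a, ~~ P a) -> cut P = 0.
Proof.
by move=> PT; apply: coproduct_ext => a; rewrite cut_inj comp0m (negPf (PT a)).
Qed.

Lemma cut_cons a s : a \notin s ->
  cut (mem (a :: s)) = inj a \c coproj a + cut (mem s).
Proof.
move=> ns; apply: coproduct_ext => b.
rewrite compmDl !cut_inj -compmA /= in_cons.
have [->|nba] := eqVneq b a; first by rewrite (negPf ns) coproj_id compm1 addr0.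
by rewrite coproj_neq 1?eq_sym// compm0 add0r.
Qed.

Lemma coproj_cut P a : P a -> coproj a \c cut P = coproj a.
Proof.
move=> Pa; apply: coproduct_ext => b; rewrite -compmA cut_inj.
case: ifPn => // nPb; rewrite compm0 coproj_neq//.
by apply: contraNneq nPb => <-.
Qed.

Lemma copair_cut X (g : forall a, hom (F a) X) P a :
  copair g \c cut P \c inj a = if P a then g a else 0.
Proof. by rewrite -compmA cut_inj; case: (P a); rewrite ?compm0 ?copairE. Qed.

End Coproduct.

(** The monomorphism [f] is the kernel of some [g], and [g] factors through [q]; so what [q] kills
    is killed by [g] and lifts through [f]. *)
Lemma mono_is_kernel_cokernel (C : preadditive) (X Y Q : C) (f : hom X Y)
    (q : hom Y Q) :
  is_abelian C -> is_mono f -> is_cokernel f q -> is_kernel q f.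
Proof.
move=> hC /(ab_mono hC)[Z [g [gf kf]]] [qf cq]; split=> // W h qh.
apply: kf; have [u [<- _]] := cq _ _ gf.
by rewrite -compmA qh compm0.
Qed.

Lemma cokernel_epi (C : preadditive) (X Y Q : C) (f : hom X Y) (q : hom Y Q) :
  is_cokernel f q -> is_epi q.
Proof.
move=> [qf cq] Z u v uv; have [|w [_ wu]] := cq Z (v \c q).
  by rewrite -compmA qf compm0.
by rewrite -(wu u uv) -(wu v).
Qed.

Lemma directed_seq_sub (A : choiceType) :
  directed (fun s t : seq A => all (mem t) s).
Proof.
split.
- by exists [::].
- by move=> s; apply/allP.
- by move=> t s u /allP st /allP tu; apply/allP => a /st/tu.
- by move=> s t; exists (s ++ t); apply/andP; split; apply/allP => a;
    rewrite /= mem_cat => ->; rewrite ?orbT.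
Qed.

(* If every [cut (predC s) \c x] were a monomorphism, with cokernel [q s], the
   sequences [X -> S -> Q s] would form a directed system: it is constant at
   [X], and for [s <= t] its map on [S] kills the summands in [t] but not in
   [s]. Its limit is [X -> S -> S] with the maps [0] and [idhom S], as the
   structure map of the middle limit at [s] is [cut s]. *)
Lemma cut_not_mono (C : preadditive) (A : choiceType) (F : A -> C) (S X : C)
    (inj : forall a, hom (F a) S) (cS : is_coproduct inj) (x : hom X S) :
  is_grothendieck C -> idhom X <> 0 ->
  exists s : seq A, ~ is_mono (cut cS (predC (mem s)) \c x).
Proof.
move=> hC X0; apply: contrapT => /forallNP nm.
have hA := gr_abelian hC.
pose f (s : seq A) := cut cS (predC (mem s)) \c x.
have mono_f s : is_mono (f s) by apply: contrapT => /nm.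
pose le (s t : seq A) := all (mem t) s.
have leP s t a : le s t -> a \in s -> a \in t by move=> /allP; apply.
pose m2 (s t : seq A) := cut cS [pred a | (a \in s) || (a \notin t)].
have @D1 : direct_system C le.
  by apply: (@DirectSystem C _ le (fun=> X) (fun _ _ _ => idhom X)) => *;
    rewrite ?comp1m.
have @D2 : direct_system C le.
  apply: (@DirectSystem C _ le (fun=> S) (fun s t _ => m2 s t)).
    by move=> s _; apply: cut_id => a /=; case: (a \in s).
  move=> s t u st tu _; rewrite cut_comp; apply: eq_cut => a /=.
  move: (leP _ _ a st) (leP _ _ a tu).
  by case: (a \in s); case: (a \in t); case: (a \in u) => //= h1 h2;
    rewrite ?h1 ?h2//; move: (h1 isT) (h2 isT).
pose Q (s : seq A) : C := sval (cid (ab_cokernel hA (f s))).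
pose q s : hom S (Q s) := sval (cid (svalP (cid (ab_cokernel hA (f s))))).
have cq s : is_cokernel (f s) (q s).
  exact: (svalP (cid (svalP (cid (ab_cokernel hA (f s)))))).
have qe s := cokernel_epi (cq s).
have nat_f s t : le s t -> m2 s t \c f s = f t.
  move=> st; rewrite /f compmA cut_comp; congr (_ \c x); apply: eq_cut => a /=.
  by move: (leP _ _ a st); case: (a \in s); case: (a \in t) => // ->.
have ex_m3 s t (h : le s t) :
    exists m : hom (Q s) (Q t), m \c q s = q t \c m2 s t.
  have [|m [mq _]] := (cq s).2 _ (q t \c m2 s t).
    by rewrite -compmA nat_f//; case: (cq t).
  by exists m.
pose m3 s t h : hom (Q s) (Q t) := sval (cid (ex_m3 s t h)).
have m3E s t h : m3 s t h \c q s = q t \c m2 s t.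
  exact: (svalP (cid (ex_m3 s t h))).
have @D3 : direct_system C le.
  apply: (@DirectSystem C _ le Q m3).
    move=> s h; apply: qe; rewrite m3E comp1m.
    by rewrite [m2 _ _](ds_id D2 h) compm1.
  move=> s t u st tu su; apply: qe; rewrite -compmA !m3E compmA m3E -compmA.
  by rewrite [m2 t u \c m2 s t](ds_comp D2 st tu su).
have ex_c3 s : exists c : hom (Q s) S, c \c q s = cut cS (mem s).
  have [|c [cE _]] := (cq s).2 _ (cut cS (mem s)); last by exists c.
  rewrite /f compmA cut_comp cut0 ?comp0m// => a /=.
  by case: (a \in s).
pose c3 s : hom (Q s) S := sval (cid (ex_c3 s)).
have c3E s : c3 s \c q s = cut cS (mem s) by exact: (svalP (cid (ex_c3 s))).
have cut_m2 s t : le s t -> cut cS (mem t) \c m2 s t = cut cS (mem s).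
  move=> st; rewrite cut_comp; apply: eq_cut => a /=.
  by move: (leP _ _ a st); case: (a \in s); case: (a \in t) => // ->.
have lim2 : is_direct_limit (D := D2) (fun s => cut cS (mem s)).
  split=> [s t h|Z g cg]; first exact: cut_m2.
  (* For [a] outside [s], the map from [s] to [a :: s] kills [inj a]; hence a cocone is determined
     by its components at the singletons. *)
  have gE s a : g s \c inj a = if a \in s then g [:: a] \c inj a else 0.
    case: ifPn => as_.
      have h : le [:: a] s by rewrite /le/= as_.
      by rewrite -(cg _ _ h) -compmA cut_inj /= mem_seq1 eqxx.
    have h : le s (a :: s).
      by apply/allP => b; rewrite /= in_cons => ->; rewrite orbT.
    rewrite -(cg _ _ h) -compmA cut_inj /= (negPf as_) mem_head.
    exact: compm0.
  exists (copair cS (fun a => g [:: a] \c inj a)); split=> [s|u ug].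
    by apply: (coproduct_ext cS) => a; rewrite copair_cut [RHS]gE.
  apply: (coproduct_ext cS) => a; rewrite copairE -ug -compmA cut_inj/=.
  by rewrite mem_seq1 eqxx.
have : short_exact (0 : hom X S) (idhom S).
  apply: (gr_exact hC (directed_seq_sub A) (D1 := D1) (D2 := D2) (D3 := D3)
    (f := f) (g := q) _ _ _ (c1 := fun=> idhom X)
    (c2 := fun s => cut cS (mem s)) (c3 := c3)).
  - by move=> s t h; rewrite compm1 nat_f.
  - by move=> s t h; rewrite m3E.
  - by move=> s; split; [exact: mono_is_kernel_cokernel|exact: cq].
  - split=> [s t h|Z g cg]; first by rewrite comp1m.
    exists (g [::]); split=> [s|u ug]; last by rewrite -(ug [::]) compm1.
    have h : le [::] s by [].
    by rewrite compm1 -(cg _ _ h) /= compm1.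
  - exact: lim2.
  - split=> [s t h|Z g cg].
      by apply: (qe s); rewrite -compmA m3E compmA !c3E cut_m2.
    have [|u [ug uu]] := lim2.2 Z (fun s => g s \c q s).
      by move=> s t h; rewrite /= -(cg _ _ h) -!compmA m3E.
    exists u; split=> [s|v vg]; first by apply: (qe s); rewrite -compmA c3E ug.
    by apply: uu => s; rewrite -vg -compmA c3E.
  - move=> s; rewrite comp0m /f compmA cut_comp cut0 ?comp0m// => a /=.
    by case: (a \in s).
  - by move=> s; rewrite comp1m c3E.
(* Since [0 : X -> S] is now a kernel of [idhom S], it factors through itself uniquely; yet
   [idhom X] and [0] are both such factorizations. *)
move=> [[_ ker0] _]; have [|u [_ uu]] := ker0 X 0; first by rewrite compm0.
by apply: X0; rewrite -(uu (idhom X)) ?comp0m// -(uu 0) ?comp0m.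
Qed.

(* For some [s], [y \c cut (predC s) \c x] is not mono, so it is not invertible;
   as [X] is local, [y \c cut s \c x] is, and hence so is one of its finitely
   many terms. *)
Lemma local_factor_coproduct (C : preadditive) (A : choiceType) (F : A -> C)
    (S X : C) (inj : forall a, hom (F a) S) (cS : is_coproduct inj)
    (x : hom X S) (y : hom S X) :
  is_grothendieck C -> has_local_endo X -> is_iso (y \c x) ->
  exists a, is_iso (y \c inj a \c (coproj cS a \c x)).
Proof.
move=> hC lX yx; have [s ns] := cut_not_mono cS x hC (local_endo_id lX).
have : is_iso (y \c cut cS (mem s) \c x + y \c cut cS (predC (mem s)) \c x).
  by rewrite -compmDl -compmDr cut_compl compm1.
case/(local_endo_add lX) => [{ns}|/is_iso_mono]; last first.
  by rewrite -compmA => /is_mono_compr/ns.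
elim: s => [|a s IHs].
  rewrite cut0// compm0 comp0m => -[h [h0 _]]; case: (local_endo_id lX).
  by rewrite -h0 compm0.
have [as_|nas] := boolP (a \in s).
  rewrite (@eq_cut _ _ _ _ _ cS _ (mem s)) => [|b /=]; first exact: IHs.
  by rewrite in_cons; have [->|] := eqVneq b a; rewrite ?as_.
rewrite cut_cons// compmDr compmDl => /(local_endo_add lX)[|/IHs//].
by rewrite !compmA => h; exists a; rewrite !compmA.
Qed.

(** For [a] outside the [s] of [cut_not_mono], [coproj cS a \c x] factors through
    [cut cS (predC (mem s)) \c x], which is not mono. *)
Lemma finite_mono_coproj (C : preadditive) (A : choiceType) (F : A -> C)
    (S X : C) (inj : forall a, hom (F a) S) (cS : is_coproduct inj)
    (x : hom X S) :
  is_grothendieck C -> idhom X <> 0 ->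
  finite_set [set a | is_mono (coproj cS a \c x)].
Proof.
move=> hC X0; have [s ns] := cut_not_mono cS x hC X0.
apply: (@sub_finite_set _ _ [set` s]); last exact: finite_seq.
move=> a /= ma; apply: contrapT => /negP as_; apply: ns.
apply: (@is_mono_compr _ _ _ _ (coproj cS a)).
by rewrite compmA coproj_cut.
Qed.

(** * Cardinality *)

Section Cardinality.
Local Open Scope card_scope.

(** An infinite [D] would contain finite sets larger than [E]. The bound is phrased with sequences
    to match [local_linear_system]. *)
Lemma finite_card_le (T U : choiceType) (D : set T) (E : set U) :
  finite_set E ->
  (forall (s : seq U) (t : seq T), [set` s] = E -> [set` t] `<=` D -> uniq t ->
    (size t <= size s)%N) ->
  D #<= E.
Proof.
move=> /finite_fsetP[X ->] /(_ (enum_fset X) _ erefl) le_t.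
have [/finite_fsetP[Y DY]|/infinite_set_fset-/(_ #|`X|.+1)[Y YD]] :=
    pselect (finite_set D); last first.
  by rewrite ltnNge le_t.
have Xn : [set` X] #= `I_#|`X| by apply/card_eq_fsetP.
have Yn : [set` Y] #= `I_#|`Y| by apply/card_eq_fsetP.
rewrite DY (card_le_eql Yn) (card_le_eqr Xn) card_le_II; apply: le_t => //.
by rewrite DY.
Qed.

(** Zorn's lemma gives a maximal disjoint family of countably infinite subsets; an infinite
    remainder would contain one more such subset. *)
Lemma infinite_partition (U : Type) (E : set U) : infinite_set E ->
  exists2 P : set (set U),
    (forall X, P X -> [/\ X `<=` E, infinite_set X & countable X]) /\
    trivIset P id
  & finite_set (E `\` \bigcup_(X in P) X).
Proof.
move=> infE.
pose good (P : set (set U)) :=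
  (forall X, P X -> [/\ X `<=` E, infinite_set X & countable X]) /\
  trivIset P id.
have [F Fgood Fchain|P [gP maxP]] := @Zorn_bigcup _ good.
  split=> [X [P FP PX]|X Y [P FP PX] [Q FQ QY]].
    by have [/(_ X PX)] := Fgood P FP.
  have [PQ|QP] := Fchain P Q FP FQ.
    by have [_] := Fgood Q FQ; apply => //; exact: PQ.
  by have [_] := Fgood P FP; apply => //; exact: QP.
exists P => //; apply: contrapT => /infiniteP/card_subP[X Xnat XE].
have infX : infinite_set X.
  by apply/infiniteP; rewrite (card_le_eqr Xnat) card_lexx.
have [x Xx] := infinite_setN0 infX.
have PX : ~ P X by move=> PX; have [_] := XE x Xx; apply; exists X.
apply: (maxP (P `|` [set X])).
  split; first by left.
  by move=> PXP; apply/PX/PXP; right.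
have XP Y : P Y -> X `&` Y !=set0 -> False.
  by move=> PY [y [Xy Yy]]; have [_] := XE y Xy; apply; exists Y.
have [gP1 gP2] := gP.
split=> [Y [/gP1//|->]|Y Z [PY|->] [PZ|->]//].
- split=> //; first by move=> y /XE[].
  by rewrite /countable (card_le_eql Xnat) card_lexx.
- exact: gP2.
- by rewrite setIC => /XP-/(_ PY).
- by move=> /XP-/(_ PZ).
Qed.

(* [E] is partitioned into countably infinite sets, up to a finite set merged
   into one of them, and the preimage of each of these sets is countable. *)
Lemma infinite_card_le (T U : Type) (D : set T) (E : set U) (f : T -> U) :
  infinite_set E -> (forall a, D a -> E (f a)) ->
  (forall b, E b -> countable (D `&` f @^-1` [set b])) ->
  D #<= E.
Proof.
elim/Ppointed: U => U in E f *; first by rewrite !emptyE.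
move=> infE fE cf; have [P [gP tP] finR] := infinite_partition infE.
pose R := E `\` \bigcup_(X in P) X.
have [X0 PX0] : exists X0, P X0.
  apply: contrapT => /forallNP nP; apply: infE; apply: sub_finite_set finR.
  by move=> b Eb; split=> // -[X /nP].
have /choice[blk blkP] b : exists X, E b -> P X /\ (X `|` R) b.
  have [[X PX Xb]|nb] := pselect ((\bigcup_(X in P) X) b).
    by exists X => _; split=> //; left.
  by exists X0 => Eb; split=> //; right.
pose DX X := D `&` [set a | blk (f a) = X].
have /choice[h hP] X : exists h : T -> U,
    P X -> set_fun (DX X) X h /\ set_inj (DX X) h.
  have [PX|] := pselect (P X); last by exists (fun=> point).
  have [XE iX cX] := gP X PX.
  have : DX X #<= X.
    apply: (@card_le_trans _ _ _ [set: nat]); last by apply/infiniteP.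
    apply: (@sub_countable _ _ _
      (\bigcup_(b in X `|` R) (D `&` f @^-1` [set b]))).
      apply: subset_card_le => a [Da aX]; exists (f a) => //.
      by rewrite -aX; case: (blkP _ (fE _ Da)).
    apply: bigcup_countable => [|b Xb]; last by apply: cf; case: Xb => [/XE|[]].
    rewrite -bigcup2E; apply: bigcup_countable => // -[|[|i]] _ //=.
    exact: finite_set_countable.
  by move=> /pcard_leP[g]; exists g => _; split; [exact: funS|exact: inj].
apply/pcard_leP/injfunPex; exists (fun a => h (blk (f a)) a).
  move=> a Da; have [PX _] := blkP _ (fE _ Da).
  by have [hX _] := hP _ PX; have [XE _ _] := gP _ PX; exact/XE/hX.
move=> a a' /set_mem Da /set_mem Da' haa'.
have [PX _] := blkP _ (fE _ Da); have [PX' _] := blkP _ (fE _ Da').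
have [hX hXinj] := hP _ PX; have [hX' _] := hP _ PX'.
(* The common value lies in both blocks, and distinct blocks are disjoint. *)
have XX' : blk (f a) = blk (f a').
  apply: (tP _ _ PX PX'); exists (h (blk (f a)) a); split; first exact: hX.
  by rewrite haa'; exact: hX'.
by apply: hXinj; rewrite ?inE//; rewrite haa' XX'.
Qed.

(** Bijections between the fibres over each [k], chosen once and for all, glue to one over [K]. *)
Lemma card_eq_fibers (T U K : Type) (kT : T -> K) (kU : U -> K) :
  (forall k, [set a | kT a = k] #= [set b | kU b = k]) ->
  exists (f : T -> U) (g : U -> T),
    [/\ cancel f g, cancel g f & forall a, kU (f a) = kT a].
Proof.
move=> kTU; pose DT k := [set a | kT a = k]; pose DU k := [set b | kU b = k].
have uv k : exists uv : (DT k -> DU k) * (DU k -> DT k),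
    cancel uv.1 uv.2 /\ cancel uv.2 uv.1.
  by have /card_bijP[u [v uK vK]] := kTU k; exists (u, v).
pose u k := (sval (cid (uv k))).1; pose v k := (sval (cid (uv k))).2.
have uK k : cancel (u k) (v k) by rewrite /u /v; case: cid => ? [].
have vK k : cancel (v k) (u k) by rewrite /u /v; case: cid => ? [].
have inT a : a \in DT (kT a) by rewrite inE.
have inU b : b \in DU (kU b) by rewrite inE.
pose f a := \val (u _ (SigSub (inT a))).
pose g b := \val (v _ (SigSub (inU b))).
have fE k (x : DT k) : f (\val x) = \val (u k x).
  case: x => a ak; have := set_mem ak; rewrite /= => {}/esym ek.
  by subst k; rewrite /f; congr (\val (u _ _)); exact: val_inj.
have gE k (x : DU k) : g (\val x) = \val (v k x).
  case: x => a ak; have := set_mem ak; rewrite /= => {}/esym ek.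
  by subst k; rewrite /g; congr (\val (v _ _)); exact: val_inj.
exists f, g; split=> [a|b|a].
- by rewrite {1}/f gE uK.
- by rewrite {1}/g fE vK.
- exact: set_mem (valP (u _ (SigSub (inT a)))).
Qed.

End Cardinality.

(** The value at [a] is transported along [k a = t]; injectivity makes it independent of [a]. With
    [P] dependent, this covers families of morphisms as well as of objects. *)
Lemma extend_along (A T : Type) (k : A -> T) (P : T -> Type)
    (g : forall a, P (k a)) (g0 : forall t, P t) : injective k ->
  exists h : forall t, P t, (forall a, h (k a) = g a) /\
    (forall t, (forall a, k a <> t) -> h t = g0 t).
Proof.
move=> kinj.
have ex t : exists w : P t,
    (forall a (e : k a = t), w = ecast x (P x) e (g a)) /\
    ((forall a, k a <> t) -> w = g0 t).
  have [[a e]|/forallNP ne] := pselect (exists a, k a = t).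
    exists (ecast x (P x) e (g a)); split; last by move=> /(_ a).
    move=> a' e'; have aa' : a = a' by apply: kinj; rewrite e e'.
    by case: _ / aa' e' => e'; rewrite (Prop_irrelevance e e').
  by exists (g0 t); split=> // a e; case: (ne a).
exists (fun t => sval (cid (ex t))); split=> [a|t].
  by have [h _] := svalP (cid (ex (k a))); exact: (h a erefl).
by have [_] := svalP (cid (ex t)).
Qed.

(** * Uniqueness of decompositions *)

Section Azumaya.
Variables (C : preadditive) (hC : is_grothendieck C) (N : C).
Local Open Scope card_scope.

(** The predicate [isomorphic X] serves as the isomorphism class of [X], so that classes can be the
    labels in [card_eq_fibers]. *)
Lemma isomorphic_eq (X Y : C) : isomorphic X Y <-> isomorphic X = isomorphic Y.
Proof.
split=> [XY|->]; last exact: isomorphic_refl.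
apply/funext => Z; apply/propext; split; last exact: isomorphic_trans.
exact/isomorphic_trans/isomorphic_sym.
Qed.

Lemma local_summands_card_le (A B : choiceType) (G : A -> C) (H : B -> C)
    (i : forall a, hom (G a) N) (j : forall b, hom (H b) N) (X : C) :
  is_coproduct i -> is_coproduct j ->
  (forall a, has_local_endo (G a)) -> (forall b, has_local_endo (H b)) ->
  has_local_endo X ->
  [set a | isomorphic X (G a)] #<= [set b | isomorphic X (H b)].
Proof.
move=> ci cj lG lH lX; have X0 := local_endo_id lX.
have [finJ|infJ] := pselect (finite_set [set b | isomorphic X (H b)]).
  apply: finite_card_le => // s t sJ tI ut; rewrite leqNgt; apply/negP => st.
  have [c [[l lt [c' [c'c _]]] nc]] := local_linear_system
    (fun b a => coproj cj b \c i a) lX (fun a _ => lG a) (fun b _ => lH b)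
    (fun a => tI a) ut st.
  pose x := \sum_(a <- t) (i a \c c a).
  (* Hence [c' \c coproj ci l] is a left inverse of [x], which therefore has an invertible component
     at some [b], contrary to [nc]. *)
  have px : coproj ci l \c x = c l.
    rewrite compm_sumr (big_rem l lt)/= compmA coproj_id comp1m.
    rewrite big1_seq ?addr0// => a /andP[_]; rewrite mem_rem_uniq// inE.
    by move=> /andP[al _]; rewrite compmA coproj_neq 1?eq_sym// comp0m.
  have [|b] := local_factor_coproduct cj (x := x)
    (y := c' \c coproj ci l) hC lX.
    by rewrite -compmA px c'c; exists (idhom X); rewrite comp1m.
  move=> /(local_endo_comp (lH b) X0)[bx _].
  have Jb : [set b | isomorphic X (H b)] b.
    by have [y yP] := bx; exists (coproj cj b \c x), y.
  move: Jb; rewrite -sJ /= => /nc; apply.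
  rewrite (_ : \sum_(_ <- _) _ = coproj cj b \c x)//.
  by rewrite compm_sumr; apply: eq_bigr => a _; rewrite compmA.
(* The identity of [G a] factors through [N], hence through some [H b]; that [coproj ci a \c j b] is
   mono is kept for the finiteness of the fibres of [f]. *)
have /choice[f fP] a : exists b,
    isomorphic (G a) (H b) /\ is_mono (coproj ci a \c j b).
  have [|b] := local_factor_coproduct cj (x := i a) (y := coproj ci a)
    hC (lG a).
    by rewrite coproj_id; exists (idhom (G a)); rewrite comp1m.
  move=> /(local_endo_comp (lH b) (local_endo_id (lG a))).
  move=> [[y yP] /is_iso_mono m].
  by exists b; split=> //; exists (coproj cj b \c i a), y.
apply: (@infinite_card_le _ _ _ _ f) => // [a Xa|b _] /=.
  by have [? _] := fP a; exact: isomorphic_trans Xa _.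
apply: finite_set_countable.
apply: sub_finite_set (finite_mono_coproj ci (j b) hC (local_endo_id (lH b))).
by move=> a [_ /= <-]; case: (fP a).
Qed.

Theorem krull_remak_schmidt_azumaya (A B : choiceType) (G : A -> C) (H : B -> C)
    (i : forall a, hom (G a) N) (j : forall b, hom (H b) N) :
  is_coproduct i -> is_coproduct j ->
  (forall a, has_local_endo (G a)) -> (forall b, has_local_endo (H b)) ->
  exists (f : A -> B) (g : B -> A),
    [/\ cancel f g, cancel g f & forall a, isomorphic (G a) (H (f a))].
Proof.
move=> ci cj lG lH.
have [k|f [g [fK gK fP]]] := @card_eq_fibers A B (set C)
    (fun a => isomorphic (G a)) (fun b => isomorphic (H b)); last first.
  by exists f, g; split=> // a; apply/isomorphic_eq; rewrite fP.
have classE (I : Type) (F : I -> C) X : isomorphic X = k ->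
    [set a | isomorphic (F a) = k] = [set a | isomorphic X (F a)].
  move=> <-; apply/seteqP; split=> a /=; first by rewrite isomorphic_eq => ->.
  by rewrite isomorphic_eq => ->.
apply: Cantor_Bernstein.
  (* The label [k] ranges over all subsets of [C]; if it is the class of no [G a], the left side is
     empty. *)
  have [[a ak]|nk] := pselect (exists a, isomorphic (G a) = k).
    by rewrite !(classE _ _ _ ak); exact: local_summands_card_le ci cj _ _ _.
  rewrite (_ : [set a | _] = set0) ?card_ge0//.
  by rewrite -subset0 => a /= ak; apply: nk; exists a.
have [[b bk]|nk] := pselect (exists b, isomorphic (H b) = k).
  by rewrite !(classE _ _ _ bk); exact: local_summands_card_le cj ci _ _ _.
rewrite (_ : [set b | _] = set0) ?card_ge0//.
by rewrite -subset0 => b /= bk; apply: nk; exists b.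
Qed.

End Azumaya.

(** * Direct sums, padding by zero objects, common refinements *)

Section DirectSum.
Variable C : preadditive.
Implicit Types (M X Y : C) (A T : choiceType).

Lemma is_direct_sumP M A (F : A -> C) :
  is_direct_sum M F <-> exists i : forall a, hom (F a) M, is_coproduct i.
Proof.
split=> [[S [i [ci [f [g [gf fg]]]]]]|[i ci]]; last first.
  by exists M, i; split=> //; exact: isomorphic_refl.
exists (fun a => g \c i a) => X h; have [u [ui uu]] := ci X h.
exists (u \c f); split=> [a|v vi].
  by rewrite -compmA (compmA f) fg comp1m.
rewrite (uu (v \c g)) => [|a]; last by rewrite -compmA.
by rewrite -compmA gf compm1.
Qed.

Lemma is_direct_sum_isomorphic M M' A (F : A -> C) :
  isomorphic M M' -> is_direct_sum M' F -> is_direct_sum M F.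
Proof.
move=> MM' [S [i [ci M'S]]]; exists S, i; split=> //.
exact: isomorphic_trans MM' M'S.
Qed.

(** Morphisms out of a zero object agree, so the indices outside the image of [k] impose no
    condition. *)
Lemma is_direct_sum_extend M A T (k : A -> T) (F : T -> C) : injective k ->
  (forall t, (forall a, k a <> t) -> is_zero (F t)) ->
  is_direct_sum M F <-> is_direct_sum M (fun a => F (k a)).
Proof.
move=> kinj F0; split=> /is_direct_sumP[i ci]; apply/is_direct_sumP.
  exists (fun a => i (k a)) => X g.
  have [g' [g'E g'0]] := @extend_along A T k
    (fun t => hom (F t) X) g (fun t => 0) kinj.
  have [u [ui uu]] := ci X g'; exists u; split=> [a|v vi].
    by rewrite ui.
  apply: uu => t; have [[a <-]|/forallNP nt] := pselect (exists a, k a = t).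
    by rewrite vi g'E.
  by rewrite ((F0 t nt).1 _ (v \c _)) ((F0 t nt).1 _ (g' t)).
have [i' [i'E i'0]] := @extend_along A T k
    (fun t => hom (F t) M) i (fun t => 0) kinj.
exists i' => X g; have [u [ui uu]] := ci X (fun a => g (k a)).
exists u; split=> [t|v vi]; last by apply: uu => a; rewrite -i'E vi.
have [[a <-]|/forallNP nt] := pselect (exists a, k a = t).
  by rewrite i'E ui.
by rewrite ((F0 t nt).1 _ (u \c _)) ((F0 t nt).1 _ (g t)).
Qed.

(* [T] is [A + B]; [kB] sends the index of a local summand to that of its
   partner in [A], and the other indices to [inr]. *)
Lemma common_refinement M (A B : choiceType) (G : A -> C) (H : B -> C) (Z : C) :
  is_grothendieck C -> is_zero Z ->
  is_direct_sum M G -> is_direct_sum M H ->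
  (forall a, zero_or_local (G a)) -> (forall b, zero_or_local (H b)) ->
  exists (T : choiceType) (kA : A -> T) (kB : B -> T),
    [/\ injective kA, injective kB &
     forall G' H' : T -> C,
       (forall a, G' (kA a) = G a) ->
       (forall t, (forall a, kA a <> t) -> G' t = Z) ->
       (forall b, H' (kB b) = H b) ->
       (forall t, (forall b, kB b <> t) -> H' t = Z) ->
       forall t, isomorphic (G' t) (H' t)].
Proof.
move=> hC Z0 MG MH GA HB.
pose lA := [pred a | `[< has_local_endo (G a) >]].
pose lB := [pred b | `[< has_local_endo (H b) >]].
pose A' : choiceType := {a | lA a}; pose B' : choiceType := {b | lB b}.
have sumA : is_direct_sum M (fun a : A' => G (val a)).
  have kinj : injective (val : A' -> A) by exact: val_inj.
  apply: (is_direct_sum_extend M (F := G) kinj _).1 => //.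
  move=> a na; case: (GA a) => // /asboolP la.
  by case: (na (exist _ a la)).
have sumB : is_direct_sum M (fun b : B' => H (val b)).
  have kinj : injective (val : B' -> B) by exact: val_inj.
  apply: (is_direct_sum_extend M (F := H) kinj _).1 => //.
  move=> b nb; case: (HB b) => // /asboolP lb.
  by case: (nb (exist _ b lb)).
have [i ci] := (is_direct_sumP _ _).1 sumA.
have [j cj] := (is_direct_sumP _ _).1 sumB.
have [||f [g [fK gK fP]]] := krull_remak_schmidt_azumaya hC ci cj.
- by move=> a; exact/asboolP/(valP a).
- by move=> b; exact/asboolP/(valP b).
pose kB b : A + B := if insub b is Some b' then inl (val (g b')) else inr b.
have kB_local (b : B') : kB (val b) = inl (val (g b)) by rewrite /kB valK.
have kB_zero b : ~~ lB b -> kB b = inr b by move=> lb; rewrite /kB insubN.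
exists (A + B)%type, inl, kB; split=> [a a' []//|b b'|].
  rewrite /kB; case: insubP => [c _ <-|nb]; case: insubP => [c' _ <-|nb'] //.
    by move=> [/val_inj/(can_inj gK)->].
  by move=> [].
move=> G' H' G'E G'0 H'E H'0 [a|b].
  (* At [inl a], a local [G a] meets its partner; if [G a] is zero, no [b] is sent to [inl a], so
     [H'] is [Z] there. *)
  rewrite G'E; have [la|nla] := boolP (lA a).
    have -> : inl a = kB (val (f (exist _ a la))) by rewrite kB_local fK.
    by rewrite H'E; exact: (fP (exist _ a la)).
  have -> : H' (inl a) = Z.
    apply: H'0 => b; rewrite /kB; case: insubP => // b' _ _ [ab].
    by move: nla; rewrite -ab (valP (g b')).
  by case: (GA a) => [/is_zero_isomorphic|/asboolP/idPn]; [exact|rewrite nla].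
(* At [inr b], a local [H b] has been moved to the index of its partner, which leaves [Z]; otherwise
   [H b] is itself zero. *)
have -> : G' (inr b) = Z by exact: G'0.
have [lb|nlb] := boolP (lB b).
  rewrite H'0; first exact: isomorphic_refl.
  move=> b'; rewrite /kB; case: insubP => // nb' [bb'].
  by move: nb'; rewrite bb' lb.
rewrite -(kB_zero b nlb) H'E.
case: (HB b) => [/(is_zero_isomorphic Z0)//|/asboolP lb].
by move: nlb; rewrite /= lb.
Qed.

End DirectSum.

(** * Minkowski's inequality *)

Section LpNorm.
Variable R : realType.
Local Open Scope ereal_scope.

(* Convexity of [z `^ r] at [x / a] and [y / b] with weights [a / (a + b)] and
   [b / (a + b)]; in Minkowski's inequality [a] and [b] are the two norms. *)
Lemma powR_add_le (r a b x y : R) :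
  (1 <= r -> 0 < a -> 0 < b -> 0 <= x -> 0 <= y ->
  (x + y) `^ r <= (a + b) `^ r * (a / (a + b) / a `^ r) * x `^ r +
                  (a + b) `^ r * (b / (a + b) / b `^ r) * y `^ r)%R.
Proof.
move=> r1 a0 b0 x0 y0; have ab0 : (0 < a + b)%R by exact: addr_gt0.
have ar0 : (a `^ r != 0)%R by rewrite gt_eqF// powR_gt0.
have br0 : (b `^ r != 0)%R by rewrite gt_eqF// powR_gt0.
pose X := (x / a)%R; pose Y := (y / b)%R.
have X0 : (0 <= X)%R by rewrite divr_ge0// ltW.
have Y0 : (0 <= Y)%R by rewrite divr_ge0// ltW.
have -> : x = (a * X)%R by rewrite mulrC divfK// gt_eqF.
have -> : y = (b * Y)%R by rewrite mulrC divfK// gt_eqF.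
clearbody X Y.
have t0 : (0 <= a / (a + b))%R by rewrite divr_ge0// ltW.
have t1 : (a / (a + b) <= 1)%R by rewrite ler_pdivrMr// mul1r lerDl ltW.
have tE : (1 - a / (a + b) = b / (a + b))%R by field; rewrite gt_eqF.
have : ((a / (a + b) * X + (1 - a / (a + b)) * Y) `^ r <=
    a / (a + b) * X `^ r + (1 - a / (a + b)) * Y `^ r)%R.
  by apply: (convex_powR r1 (Itv01 t0 t1)); rewrite inE/= in_itv/= andbT.
rewrite tE.
(* The factor is absorbed into the power on the left, where the base becomes [a * X + b * Y]. *)
move=> /(ler_wpM2l (powR_ge0 (a + b) r)).
have s0 : (0 <= b / (a + b))%R by rewrite divr_ge0// ltW.
rewrite -powRM ?(ltW ab0)//; last by rewrite addr_ge0// mulr_ge0.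
have -> : ((a + b) * (a / (a + b) * X + b / (a + b) * Y) = a * X + b * Y)%R.
  by field; rewrite gt_eqF.
move=> /le_trans; apply; rewrite !powRM ?(ltW a0) ?(ltW b0)// le_eqVlt.
apply/orP; left; apply/eqP.
by field; rewrite ar0 br0 gt_eqF.
Qed.

Lemma ge0_esumZl (A : choiceType) (c : \bar R) (f : A -> \bar R) : 0 <= c ->
  (forall a, 0 <= f a) ->
  \esum_(a in [set: A]) (c * f a) <= c * \esum_(a in [set: A]) f a.
Proof.
move=> c0 f0; apply: ge_ereal_sup => _ [D FD <-].
rewrite -ge0_mule_fsumr//; apply: lee_wpmul2l => //.
by apply: ereal_sup_ubound; exists D.
Qed.

Section Norm.
Variables (p : \bar R) (p1 : 1 <= p).
Implicit Types A T : choiceType.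

Lemma poweRK (x : \bar R) (r : R) : (0 < r)%R -> 0 <= x -> (x `^ r) `^ r^-1 = x.
Proof. by move=> r0 x0; rewrite -poweRrM divff ?gt_eqF// poweRe1. Qed.

Lemma poweRVK (x : \bar R) (r : R) : (0 < r)%R -> 0 <= x ->
  (x `^ r^-1) `^ r = x.
Proof. by move=> r0 x0; rewrite -poweRrM mulVf ?gt_eqF// poweRe1. Qed.

Lemma ge0_le_poweR (x y : \bar R) (r : R) : (0 <= r)%R -> 0 <= x -> x <= y ->
  x `^ r <= y `^ r.
Proof.
move=> r0 x0 xy; apply: gt0_ler_poweR => //; rewrite in_itv/= leey andbT//.
exact: le_trans xy.
Qed.

Lemma lp_norm_ge0 A (x : A -> \bar R) : 0 <= lp_norm p x.
Proof.
case: p => [r| |] //=; first exact: poweR_ge0.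
by apply: ereal_sup_ubound; left.
Qed.

Lemma le_lp_norm A (x y : A -> \bar R) : (forall a, 0 <= x a) ->
  (forall a, x a <= y a) -> lp_norm p x <= lp_norm p y.
Proof.
move=> x0 xy; case: p p1 => [r||] //=.
  rewrite lee_fin => r1; have r0 : (0 < r)%R by exact: lt_le_trans r1.
  apply: ge0_le_poweR; first by rewrite invr_ge0 ltW.
    by apply: esum_ge0 => a _; exact: poweR_ge0.
  by apply: le_esum => a _; apply: ge0_le_poweR => //; exact: ltW.
move=> _; apply: ge_ereal_sup => _ [->|[a _ <-]].
  by apply: ereal_sup_ubound; left.
by apply: le_ereal_sup_tmp; exists (y a) => //; right; exists a.
Qed.

Lemma lp_norm_coord A (x : A -> \bar R) a : (forall a, 0 <= x a) ->
  x a <= lp_norm p x.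
Proof.
move=> x0; case: p p1 => [r||] //=; last first.
  by move=> _; apply: ereal_sup_ubound; right; exists a.
rewrite lee_fin => r1; have r0 : (0 < r)%R by exact: lt_le_trans r1.
rewrite -{1}(poweRK r0 (x0 a)); apply: ge0_le_poweR; rewrite ?poweR_ge0//.
  by rewrite invr_ge0 ltW.
apply: esum_ge; exists [set a]; first by split.
by rewrite fsbig_set1.
Qed.

(** The padding contributes zero terms to the sum since [r > 0], and for [+oo] only the value [0],
    already included in the supremum. *)
Lemma lp_norm_extend A T (k : A -> T) (x : T -> \bar R) : injective k ->
  (forall t, (forall a, k a <> t) -> x t = 0) ->
  lp_norm p (fun a => x (k a)) = lp_norm p x.
Proof.
move=> kinj x0; case: p p1 => [r||] //=.
  rewrite lee_fin => r1; have r0 : (0 < r)%R by exact: lt_le_trans r1.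
  congr (_ `^ _).
  rewrite -(@esum_image _ _ _ setT k (fun t => x t `^ r)); last first.
    by move=> a b _ _ /kinj.
  rewrite esum_mkcond; apply: eq_esum => t _; case: ifPn => // /negP nt.
  rewrite x0 ?poweR0r ?gt_eqF// => a at_.
  by apply: nt; rewrite inE; exists a.
move=> _; congr (ereal_sup _).
apply/seteqP; split=> [_ [->|[a _ <-]]|_ [->|[t _ <-]]].
- by left.
- by right; exists (k a).
- by left.
have [[a <-]|/forallNP nt] := pselect (exists a, k a = t).
  by right; exists a.
by left; rewrite x0.
Qed.

Lemma lp_norm0 A (x : A -> \bar R) : (forall a, x a = 0) -> lp_norm p x = 0.
Proof.
move=> x0; case: p p1 => [r||] //=.
  rewrite lee_fin => r1; have r0 : (0 < r)%R by exact: lt_le_trans r1.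
  rewrite esum1 ?poweR0r// ?gt_eqF ?invr_gt0// => a _.
  by rewrite x0 poweR0r// gt_eqF.
move=> _; apply/eqP; rewrite eq_le; apply/andP; split.
  by apply: ge_ereal_sup => _ [->|[a _ <-]] //; rewrite x0.
by apply: ereal_sup_ubound; left.
Qed.

(** If a norm is infinite the bound is trivial, and if one is zero its family vanishes; otherwise
    [powR_add_le] is summed over the indices. *)
Lemma lp_norm_minkowski A (x y : A -> \bar R) :
  (forall a, 0 <= x a) -> (forall a, 0 <= y a) ->
  lp_norm p (fun a => x a + y a) <= lp_norm p x + lp_norm p y.
Proof.
move=> x0 y0; have xy0 a : 0 <= x a + y a by exact: adde_ge0.
have [xoo|xfin] := eqVneq (lp_norm p x) +oo.
  by rewrite xoo addye ?leey// gt_eqF// (lt_le_trans _ (lp_norm_ge0 _)).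
have [yoo|yfin] := eqVneq (lp_norm p y) +oo.
  by rewrite yoo addey ?leey// gt_eqF// (lt_le_trans _ (lp_norm_ge0 _)).
have [xe|xn0] := eqVneq (lp_norm p x) 0.
  rewrite xe add0e; apply: le_lp_norm => // a.
  suff -> : x a = 0 by rewrite add0e.
  by apply/eqP; rewrite eq_le x0 andbT -xe lp_norm_coord.
have [ye|yn0] := eqVneq (lp_norm p y) 0.
  rewrite ye adde0; apply: le_lp_norm => // a.
  suff -> : y a = 0 by rewrite adde0.
  by apply/eqP; rewrite eq_le y0 andbT -ye lp_norm_coord.
have xoo a : x a < +oo by rewrite (le_lt_trans (lp_norm_coord a x0))// ltey.
have yoo a : y a < +oo by rewrite (le_lt_trans (lp_norm_coord a y0))// ltey.
have xf a : x a \is a fin_num by rewrite ge0_fin_numE.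
have yf a : y a \is a fin_num by rewrite ge0_fin_numE.
have nx : lp_norm p x \is a fin_num by rewrite ge0_fin_numE ?lp_norm_ge0// ltey.
have ny : lp_norm p y \is a fin_num by rewrite ge0_fin_numE ?lp_norm_ge0// ltey.
pose a := fine (lp_norm p x); pose b := fine (lp_norm p y).
have aE : lp_norm p x = a%:E by rewrite fineK.
have bE : lp_norm p y = b%:E by rewrite fineK.
have a0 : (0 < a)%R by rewrite -lte_fin -aE lt_neqAle eq_sym xn0 lp_norm_ge0.
have b0 : (0 < b)%R by rewrite -lte_fin -bE lt_neqAle eq_sym yn0 lp_norm_ge0.
rewrite aE bE; move: p1 aE bE; case: p => [r||] //=; last first.
  move=> _ aE bE; apply: ge_ereal_sup => _ [->|[c _ <-]].
    by rewrite lee_fin addr_ge0 ?ltW.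
  by rewrite leeD// -?aE -?bE; apply: ereal_sup_ubound; right; exists c.
rewrite lee_fin => r1 aE bE; have r0 : (0 < r)%R by exact: lt_le_trans r1.
have aE' : \esum_(i in [set: A]) x i `^ r = (a `^ r)%:E.
  rewrite -poweR_EFin -aE poweRVK//.
  by apply: esum_ge0 => i _; exact: poweR_ge0.
have bE' : \esum_(i in [set: A]) y i `^ r = (b `^ r)%:E.
  rewrite -poweR_EFin -bE poweRVK//.
  by apply: esum_ge0 => i _; exact: poweR_ge0.
have ab0 : (0 < a + b)%R by exact: addr_gt0.
rewrite -[leRHS](poweRK r0); last by rewrite lee_fin ltW.
apply: ge0_le_poweR; first by rewrite invr_ge0 ltW.
  by apply: esum_ge0 => i _; exact: poweR_ge0.
pose ca := ((a + b) `^ r * (a / (a + b) / a `^ r))%R.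
pose cb := ((a + b) `^ r * (b / (a + b) / b `^ r))%R.
have ca0 : (0 <= ca)%R.
  by rewrite mulr_ge0 ?powR_ge0// !divr_ge0 ?powR_ge0 ?ltW.
have cb0 : (0 <= cb)%R.
  by rewrite mulr_ge0 ?powR_ge0// !divr_ge0 ?powR_ge0 ?ltW.
apply: (@le_trans _ _ (\esum_(i in [set: A])
    (ca%:E * x i `^ r + cb%:E * y i `^ r))).
  apply: le_esum => i _; rewrite -(fineK (xf i)) -(fineK (yf i)).
  rewrite -EFinD !poweR_EFin -!EFinM -EFinD lee_fin.
  by apply: powR_add_le => //; exact: fine_ge0.
rewrite esumD; [|by move=> i _; rewrite mule_ge0 ?lee_fin ?poweR_ge0..].
apply: (@le_trans _ _ (ca%:E * (a `^ r)%:E + cb%:E * (b `^ r)%:E)).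
  rewrite -aE' -bE'; apply: leeD; apply: ge0_esumZl => // i; exact: poweR_ge0.
(* As [a] and [b] are the norms, the weights add up to [1] and the bound is exactly the [r]-th power
   of [a + b]. *)
rewrite poweR_EFin -!EFinM -EFinD lee_fin le_eqVlt; apply/orP; left; apply/eqP.
rewrite /ca /cb; field.
by rewrite !gt_eqF// powR_gt0.
Qed.

End Norm.
End LpNorm.

(** * The Wasserstein distance *)

Section Wasserstein.
Variables (R : realType) (C : preadditive) (hC : is_grothendieck C).
Local Open Scope ereal_scope.
Variables (d : C -> C -> \bar R) (hd : is_metric d).
Variables (p : \bar R) (p1 : 1 <= p).
Implicit Types M N Q : locally_decomposable C.

Lemma wasserstein_ge0 M N : 0 <= wasserstein p d M N.
Proof.
apply: le_ereal_inf_tmp => _ [A [F [G [_ _ _ _ ->]]]].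
exact: lp_norm_ge0.
Qed.

(** A decomposition of [N] also serves for [M], and pairing it with itself costs [0]. *)
Lemma wasserstein_iso M N : isomorphic M N -> wasserstein p d M N = 0.
Proof.
move=> MN; apply/eqP; rewrite eq_le wasserstein_ge0 andbT.
apply: ereal_inf_lbound.
have [A [F [lF NF]]] := full_prop N.
exists A, F, F; split=> //; [|by right..|].
  by apply: is_direct_sum_isomorphic NF; have [f [g ?]] := MN; exists f, g.
by rewrite lp_norm0// => a; exact: metric_refl.
Qed.

Lemma wasserstein_sym M N : wasserstein p d M N = wasserstein p d N M.
Proof.
congr (ereal_inf _); apply/seteqP.
split=> _ [A [F [G [MF NG lF lG ->]]]]; exists A, G, F; split=> //;
  by congr (lp_norm _ _); apply/funext => a; exact: metric_sym.
Qed.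

Lemma zero_or_local_extend (A T : choiceType) (k : A -> T) (F : T -> C)
    (Z : C) :
  is_zero Z -> (forall a, zero_or_local (F (k a))) ->
  (forall t, (forall a, k a <> t) -> F t = Z) ->
  forall t, zero_or_local (F t).
Proof.
move=> Z0 lF F0 t.
have [[a <-]//|/forallNP/F0 ->] := pselect (exists a, k a = t).
by left.
Qed.

(** Pairings through two decompositions of [N] are composed over a common index set, along [F1 t],
    [G1 t], [G1' t], [H1 t], where the middle step is free. *)
Lemma wasserstein_transport_le M N Q (A B : choiceType) (F G : A -> C)
    (G' H : B -> C) :
  is_direct_sum (full_val M) F -> is_direct_sum (full_val N) G ->
  is_direct_sum (full_val N) G' -> is_direct_sum (full_val Q) H ->
  (forall a, zero_or_local (F a)) -> (forall a, zero_or_local (G a)) ->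
  (forall b, zero_or_local (G' b)) -> (forall b, zero_or_local (H b)) ->
  wasserstein p d M Q <= lp_norm p (fun a => d (F a) (G a)) +
                         lp_norm p (fun b => d (G' b) (H b)).
Proof.
move=> MF NG NG' QH lF lG lG' lH.
have [Z Z0] := ab_zero (gr_abelian hC).
have [T [kA [kB [kAi kBi match_T]]]] := common_refinement hC Z0 NG NG' lG lG'.
(* The partners [F] and [H] are padded along the same maps as [G] and [G'], which keeps the pairs
   aligned. *)
have [F1 [F1E F10]] := @extend_along A T kA (fun=> C) F (fun=> Z) kAi.
have [G1 [G1E G10]] := @extend_along A T kA (fun=> C) G (fun=> Z) kAi.
have [G1' [G1'E G1'0]] := @extend_along B T kB (fun=> C) G' (fun=> Z) kBi.
have [H1 [H1E H10]] := @extend_along B T kB (fun=> C) H (fun=> Z) kBi.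
have GG' := match_T _ _ G1E G10 G1'E G1'0.
apply: (@le_trans _ _ (lp_norm p (fun t => d (F1 t) (H1 t)))).
  apply: ereal_inf_lbound; exists T, F1, H1; split=> //.
  - apply/(is_direct_sum_extend _ kAi); first by move=> t /F10 ->.
    by rewrite (_ : (fun a => F1 (kA a)) = F)//; exact/funext.
  - apply/(is_direct_sum_extend _ kBi); first by move=> t /H10 ->.
    by rewrite (_ : (fun b => H1 (kB b)) = H)//; exact/funext.
  - by apply: (zero_or_local_extend (k := kA) Z0) => // a; rewrite F1E.
  - by apply: (zero_or_local_extend (k := kB) Z0) => // b; rewrite H1E.
(* Padding only adds pairs of copies of [Z], at distance [0]. *)
have -> : lp_norm p (fun a => d (F a) (G a)) =
    lp_norm p (fun t => d (F1 t) (G1 t)).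
  rewrite -(lp_norm_extend p1 kAi) => [|t nt]; last first.
    by rewrite F10// G10// metric_refl.
  by congr (lp_norm _ _); apply/funext => a; rewrite F1E G1E.
have -> : lp_norm p (fun b => d (G' b) (H b)) =
    lp_norm p (fun t => d (G1' t) (H1 t)).
  rewrite -(lp_norm_extend p1 kBi) => [|t nt]; last first.
    by rewrite G1'0// H10// metric_refl.
  by congr (lp_norm _ _); apply/funext => b; rewrite G1'E H1E.
have d0 X Y : 0 <= d X Y by exact: metric_ge0.
apply: le_trans (lp_norm_minkowski p1 _ _) => //.
apply: le_lp_norm => // t.
apply: le_trans (metric_triangle hd _ (G1 t) _) _; rewrite leeD2l//.
apply: le_trans (metric_triangle hd _ (G1' t) _) _.
by rewrite (metric_iso hd (GG' t)) add0e.
Qed.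

Lemma wasserstein_triangle M N Q :
  wasserstein p d M Q <= wasserstein p d M N + wasserstein p d N Q.
Proof.
(* An infinite term makes the bound trivial. Finite ones can be subtracted, which allows the two
   infima to be treated one at a time. *)
have [->|MN] := eqVneq (wasserstein p d M N) +oo.
  by rewrite addye ?leey// gt_eqF// (lt_le_trans _ (wasserstein_ge0 _ _)).
have [->|NQ] := eqVneq (wasserstein p d N Q) +oo.
  by rewrite addey ?leey// gt_eqF// (lt_le_trans _ (wasserstein_ge0 _ _)).
have fMN : wasserstein p d M N \is a fin_num.
  by rewrite ge0_fin_numE ?wasserstein_ge0// ltey.
rewrite -leeBlDl//.
apply: le_ereal_inf_tmp => w [B [G' [H [NG' QH lG' lH wE]]]].
rewrite leeBlDl// addeC.
have w0 : 0 <= w by rewrite wE lp_norm_ge0.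
have [->|woo] := eqVneq w +oo.
  by rewrite addye ?leey// gt_eqF// (lt_le_trans _ (wasserstein_ge0 _ _)).
have fw : w \is a fin_num by rewrite ge0_fin_numE// ltey.
rewrite -leeBlDl//; apply: le_ereal_inf_tmp => v [A [F [G [MF NG lF lG ->]]]].
rewrite leeBlDl// addeC wE.
exact: wasserstein_transport_le MF NG NG' QH lF lG lG' lH.
Qed.

End Wasserstein.

Local Open Scope ereal_scope.

Theorem proposition5p4 (R : realType) (C : preadditive)
  (hC : is_grothendieck C) (d : C -> C -> \bar R) (hd : is_metric d)
  (p : \bar R) (hp : 1 <= p) :
  is_metric (wasserstein p d).
Proof.
split.
- exact: wasserstein_ge0.
- by move=> M; exact/wasserstein_iso/isomorphic_refl.
- exact: wasserstein_sym.
- exact: wasserstein_triangle.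
- exact: wasserstein_iso.
Qed.
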